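(* Let $\mathscr V$ be a congruence-permutable variety of topological algebras. Then, for any algebra $A\in\mathscr V$, any congruence $\sim$ on $A$, and any open subset $U\subset A$, the $\sim$-saturation of $U$, i.e., the set $\{a\in A: a\sim u \text{ for some } u\in U\}$, is open in $A$.
   Context: A signature $\Sigma$ is a set of operation symbols, each with a finite arity $n\ge 0$. A $\Sigma$-algebra is a nonempty set $A$ with an operation $\sigma\colon A^n\to A$ for each $n$-ary symbol $\sigma\in\Sigma$. A topological $\Sigma$-algebra is a $\Sigma$-algebra with a topology (no separation axioms assumed) for which all these operations are continuous. A congruence on an algebra is an equivalence relation compatible with all operations. A topological subalgebra is a subalgebra with the induced topology. The topological quotient of $A$ by a congruence $\sim$ is $A/{\sim}$ with the quotient topology, provided that the operations of $A/{\sim}$ are continuous with respect to this topology. A variety of topological algebras is a class of topological algebras of the same signature closed under the formation of topological products, topological quotients, and (topological) subalgebras (algebras being considered up to topological isomorphism). A variety is congruence-permutable if any two congruences of any algebra in the variety commute under composition of relations. *)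

(* Defs.v *)
From HB Require Import structures.
From mathcomp Require Import all_boot.
From mathcomp Require Import all_classical topology.

Set Implicit Arguments.
Unset Strict Implicit.
Unset Printing Implicit Defensive.

Local Open Scope classical_set_scope.
Local Open Scope quotient_scope.

Lemma continuous_eval (I : Type) (T : I -> topologicalType) (i : I) :
  continuous (fun x : prod_topology T => x i).
Proof. exact: (@proj_continuous {classic I} T i). Qed.

Lemma continuous_prod_topology (I : Type) (X : topologicalType)
    (T : I -> topologicalType) (f : X -> prod_topology T) :
  (forall i, continuous (fun x => f x i)) -> continuous f.
Proof.
move=> fc x; apply/cvg_sup => i.
suff fi : continuous (f : X -> initial_topology (fun g : forall j, T j => g i)).
  exact: fi.
apply/continuousP => _ [B oB <-].
by have /continuousP/(_ _ oB) := fc i.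
Qed.

Lemma continuous_initial_topology (X T : topologicalType) (Y : choiceType)
    (f : X -> Y) (g : Y -> T) :
  continuous (g \o f) -> continuous (f : X -> initial_topology g).
Proof.
move=> gfc; apply/continuousP => _ [B oB <-].
by have /continuousP/(_ _ oB) := gfc.
Qed.

Record signature := Signature {
  symbol :> Type;
  arity : symbol -> nat
}.

(* [{ptws 'I_n -> A}] is the power [A^n] with the product topology. *)
Record topalg (S : signature) := TopAlg {
  carrier :> topologicalType;
  op : forall s : S, {ptws 'I_(arity s) -> carrier} -> carrier;
  topalg_inhabited : inhabited carrier;
  op_continuous : forall s : S, continuous (@op s)
}.

Arguments op {S} t s x : rename.
Arguments op_continuous {S} t s : rename.

Section TopologicalAlgebras.
Variable S : signature.
Implicit Types A B : topalg S.

Definition is_hom A B (f : A -> B) : Prop :=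
  forall (s : S) (x : 'I_(arity s) -> A),
    f (op A s x) = op B s (fun k => f (x k)).

Definition topalg_iso A B : Prop :=
  exists (f : A -> B) (g : B -> A),
    [/\ cancel f g, cancel g f, continuous f, continuous g & is_hom f].

Section Product.
Variables (I : Type) (A : I -> topalg S).

Definition prod_op (s : S) (x : {ptws 'I_(arity s) -> prod_topology A}) :
    prod_topology A :=
  fun i => op (A i) s (fun k => x k i).

Lemma prod_inhabited : inhabited (prod_topology A).
Proof.
have h i : {x : A i | True}.
  by apply: cid; case: (topalg_inhabited (A i)) => x; exists x.
exact: (inhabits (fun i => sval (h i))).
Qed.

Lemma prod_op_continuous (s : S) : continuous (@prod_op s).
Proof.
apply: continuous_prod_topology => i x.
apply: (@continuous_comp _ {ptws 'I_(arity s) -> A i} _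
  (fun y : {ptws 'I_(arity s) -> prod_topology A} => fun k => y k i)
  (op (A i) s)); last exact: op_continuous.
move: x; apply: continuous_prod_topology => k x.
apply: (@continuous_comp _ (prod_topology A) _
  (fun y : {ptws 'I_(arity s) -> prod_topology A} => y k)
  (fun z : prod_topology A => z i)); exact: continuous_eval.
Qed.

Definition prod_alg : topalg S := TopAlg prod_inhabited prod_op_continuous.

End Product.

Definition op_closed A (X : set A) : Prop :=
  forall (s : S) (x : 'I_(arity s) -> A), (forall k, X (x k)) -> X (op A s x).

Section Subalgebra.
Variables (A : topalg S) (X : set A).
Hypotheses (X0 : X !=set0) (Xop : op_closed X).

Lemma sub_op_subproof (s : S) (x : 'I_(arity s) -> X) :
  op A s (fun k => set_val (x k)) \in X.
Proof. by apply/mem_set/Xop => k; exact: set_valP. Qed.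

(* The type [X] is [set_type X], with the topology induced by [set_val]. *)
Definition sub_op (s : S) (x : {ptws 'I_(arity s) -> X}) : X :=
  SigSub (sub_op_subproof x).

Lemma sub_inhabited : inhabited X.
Proof. by case: X0 => x Xx; exact: (inhabits (SigSub (mem_set Xx))). Qed.

Lemma sub_op_continuous (s : S) : continuous (@sub_op s).
Proof.
apply: continuous_initial_topology => x.
apply: (@continuous_comp _ {ptws 'I_(arity s) -> A} _
  (fun y : {ptws 'I_(arity s) -> X} => fun k => set_val (y k))
  (op A s)); last exact: op_continuous.
move: x; apply: continuous_prod_topology => k x.
apply: (@continuous_comp _ X _
  (fun y : {ptws 'I_(arity s) -> X} => y k) set_val).
  exact: continuous_eval.
exact: initial_continuous.
Qed.

Definition sub_alg : topalg S := TopAlg sub_inhabited sub_op_continuous.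

End Subalgebra.

(* Relations valued in [bool] are arbitrary here: by [asbool], every relation
   valued in [Prop] is the coercion of one valued in [bool]. *)
Record congruence A := Congruence {
  cong_rel :> equiv_rel A;
  cong_op : forall (s : S) (x y : 'I_(arity s) -> A),
    (forall k, cong_rel (x k) (y k)) -> cong_rel (op A s x) (op A s y)
}.

Section Quotient.
Variables (A : topalg S) (e : congruence A).

Local Notation quot_space := (quotient_topology {eq_quot e}).

Definition quot_pi : A -> quot_space := \pi_{eq_quot e}.

(* Independence of the representatives is [quot_op_pi] below. *)
Definition quot_op (s : S) (x : {ptws 'I_(arity s) -> quot_space}) :
    quot_space :=
  quot_pi (op A s (fun k => repr (x k : {eq_quot e}))).

Lemma quot_op_pi (s : S) (x : 'I_(arity s) -> A) :
  quot_op (fun k => quot_pi (x k)) = quot_pi (op A s x).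
Proof.
apply/eqmodP/cong_op => k.
by apply/eqmodP; rewrite reprK.
Qed.

Lemma quot_inhabited : inhabited quot_space.
Proof. by case: (topalg_inhabited A) => a; exact: (inhabits (quot_pi a)). Qed.

Hypothesis qc : forall s : S, continuous (@quot_op s).

Definition quot_alg : topalg S := TopAlg quot_inhabited qc.

End Quotient.

(* As [I] ranges over all types, the empty product is included. *)
Record variety (V : topalg S -> Prop) : Prop := Variety {
  variety_iso : forall A B, topalg_iso A B -> V A -> V B;
  variety_prod : forall (I : Type) (A : I -> topalg S),
    (forall i, V (A i)) -> V (prod_alg A);
  variety_sub : forall A (X : set A) (X0 : X !=set0) (Xop : op_closed X),
    V A -> V (sub_alg X0 Xop);
  variety_quot : forall A (e : congruence A)
      (qc : forall s : S, continuous (@quot_op A e s)),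
    V A -> V (quot_alg qc)
}.

Definition rel_comp (T : Type) (r1 r2 : rel T) (a c : T) : Prop :=
  exists2 b, r1 a b & r2 b c.

(* The congruences are those of the algebra; no continuity of the operations
   of the quotients is required. *)
Definition congruence_permutable (V : topalg S -> Prop) : Prop :=
  forall A, V A -> forall (e1 e2 : congruence A) (a c : A),
    rel_comp e1 e2 a c <-> rel_comp e2 e1 a c.

Definition saturation A (e : congruence A) (U : set A) : set A :=
  [set a | exists2 u, U u & e a u].

End TopologicalAlgebras.

(* Main.v *)
Require Import Defs.
From mathcomp Require Import all_boot all_classical topology.

(** The proof rests on a Mal'cev operation: a map [p : A * A * A -> A] with
    [p (x, y, y) = x] and [p (x, x, y) = y] that is continuous in its first
    argument and compatible with [e] in its third one.  Given such a [p], let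
    [a] lie in the saturation of [U], say [e a u] with [u] in [U].  The map
    [x |-> p (x, a, u)] is continuous and sends [a] to [u], so it sends every
    [x] near [a] into [U]; and [p (x, a, u)] is related to [p (x, a, a) = x].
    Hence all points near [a] are in the saturation.

    To obtain [p], run Mal'cev's argument with the following algebra in the
    role of the free algebra on three generators: the maps [A * A * A -> A]
    that are continuous in the first argument and compatible with [e] in the
    third one.  They form a subalgebra of a power of [A], hence an algebra of
    the variety, and it contains the three coordinate maps.
    Identify two such maps when they agree on all triples [(x, x, y)]:
    this is the kernel of a homomorphism, and it relates the first coordinate
    map to the second.  Identify them when they agree on all triples
    [(x, y, y)]: this relates the second coordinate map to the third.
    Permuting these two congruences yields [p] (lemma [malcev_operation]). *)

Set Implicit Arguments.
Unset Strict Implicit.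
Unset Printing Implicit Defensive.

Local Open Scope classical_set_scope.

Section Malcev.
Variable S : signature.
Implicit Types A B : topalg S.

Section Kernel.
Variables (A B : topalg S) (h : A -> B).

Definition ker_rel : rel A := fun x y => h x == h y.

Lemma ker_rel_equiv : equiv_class_of ker_rel.
Proof.
split; rewrite /ker_rel; first by move=> x.
  by move=> x y; exact: eq_sym.
by move=> y x z /eqP -> /eqP ->.
Qed.

Hypothesis h_hom : is_hom h.

Lemma ker_op (s : S) (x y : 'I_(arity s) -> A) :
  (forall k, EquivRelPack ker_rel_equiv (x k) (y k)) ->
  EquivRelPack ker_rel_equiv (op A s x) (op A s y).
Proof.
move=> xy; apply/eqP; rewrite !h_hom; congr (op B s _).
by apply/funext => k; exact/eqP/xy.
Qed.

Definition ker_congruence : congruence A := Congruence ker_op.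

End Kernel.

Lemma op_comp_continuous A (X : topologicalType) (s : S)
    (f : 'I_(arity s) -> X -> A) :
  (forall k, continuous (f k)) -> continuous (fun x => op A s (fun k => f k x)).
Proof.
move=> fc x.
apply: (@continuous_comp _ {ptws 'I_(arity s) -> A} _
  (fun x => fun k => f k x) (op A s)); last exact: op_continuous.
exact: continuous_prod_topology.
Qed.

Section TernaryMaps.
Variables (A : topalg S) (e : congruence A).

(** Both conditions hold for the coordinate maps and are inherited pointwise
    through the operations; hence they hold for every ternary term operation,
    and they are what the final argument asks of a Mal'cev term besides its
    identities. *)
Definition admissible : set (prod_alg (fun _ : A * A * A => A)) :=
  [set f | (forall y z, continuous (fun x => f (x, y, z))) /\
           (forall x y z z', e z z' -> e (f (x, y, z)) (f (x, y, z')))].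

Lemma admissible_fst : admissible (fun t => t.1.1).
Proof. by split=> [y z x|x y z z' _]; [exact: cvg_id | exact: equiv_refl]. Qed.

Lemma admissible_snd : admissible (fun t => t.1.2).
Proof. by split=> [y z x|x y z z' _]; [exact: cvg_cst | exact: equiv_refl]. Qed.

Lemma admissible_thd : admissible (fun t => t.2).
Proof. by split=> [y z x|//]; exact: cvg_cst. Qed.

Lemma admissible_nonempty : admissible !=set0.
Proof. by exists (fun t => t.1.1); exact: admissible_fst. Qed.

Lemma admissible_op_closed : op_closed admissible.
Proof.
move=> s f fadm; split=> [y z|x y z z' zz'].
  apply: (@op_comp_continuous _ _ _ (fun k x => f k (x, y, z))) => k.
  exact: (fadm k).1.
by apply: cong_op => k; exact: (fadm k).2.
Qed.

Definition admissible_alg : topalg S :=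
  sub_alg admissible_nonempty admissible_op_closed.

Definition restrict (J : Type) (d : J -> A * A * A) :
    admissible_alg -> prod_alg (fun _ : J => A) :=
  fun f j => set_val f (d j).

Lemma restrict_hom (J : Type) (d : J -> A * A * A) : is_hom (restrict d).
Proof. by []. Qed.

Variable V : topalg S -> Prop.
Hypotheses (hV : variety V) (hperm : congruence_permutable V) (hA : V A).

(** The congruences to permute are the kernels of the restrictions to the
    triples [(x, x, y)] and to the triples [(x, y, y)]: they link the first
    coordinate map to the third one through the second, and in the reverse
    order the intermediate map is the operation sought. *)
Lemma malcev_operation :
  exists2 p, admissible p & forall x y, p (x, y, y) = x /\ p (x, x, y) = y.
Proof.
pose e1 := ker_congruence (@restrict_hom (A * A) (fun t => (t.1, t.1, t.2))).
pose e2 := ker_congruence (@restrict_hom (A * A) (fun t => (t.1, t.2, t.2))).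
pose p1 : admissible_alg := SigSub (mem_set admissible_fst).
pose p2 : admissible_alg := SigSub (mem_set admissible_snd).
pose p3 : admissible_alg := SigSub (mem_set admissible_thd).
have VF : V admissible_alg.
  by apply: (variety_sub hV); apply: (variety_prod hV) => _.
have p13 : rel_comp e1 e2 p1 p3 by exists p2; exact/eqP.
have [p /eqP p1p /eqP pp3] := (hperm VF e1 e2 p1 p3).1 p13.
exists (set_val p); first exact: set_valP.
move=> x y; split.
  by have := congr1 (fun g => g (x, y)) p1p.
by have := congr1 (fun g => g (x, y)) pp3.
Qed.

End TernaryMaps.

End Malcev.

Theorem theoremB (S : signature) (V : topalg S -> Prop)
    (hV : variety V) (hperm : congruence_permutable V)
    (A : topalg S) (hA : V A) (e : congruence A) (U : set A) (hU : open U) :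
  open (saturation e U).
Proof.
have [p [pc pe] pM] := malcev_operation e hV hperm hA.
rewrite openE => a [u Uu eau].
have nearU : nbhs a [set x | U (p (x, a, u))].
  apply: (pc a u a); rewrite (pM a u).2.
  exact: open_nbhs_nbhs.
apply: filterS nearU => x Upx; exists (p (x, a, u)) => //.
by rewrite -{1}(pM x a).1; exact: pe.
Qed.
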